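(* Let $a=(a_i)_{i\in\mathbb Z}$ and $b=(b_i)_{i\in\mathbb Z}$ be two sequences of integers $\ge2$. Then $\Omega_a\cong\Omega_b$ (as topological groups) if and only if there are natural numbers $p,q\ge1$ such that $$a'=(\dots,a_{-2},qa_{-1},pa_0,a_1,\dots)\ \sim\ (\dots,b_{-2},pb_{-1},qb_0,b_1,\dots)=b',$$ that is, $\mathcal U_{a'}=\mathcal U_{b'}$, where $a'_{-1}=qa_{-1}$, $a'_0=pa_0$, $a'_i=a_i$ otherwise, and $b'_{-1}=pb_{-1}$, $b'_0=qb_0$, $b'_i=b_i$ otherwise.
   Context: For a sequence $a=(a_i)_{i\in\mathbb Z}$ of integers $a_i\ge2$, let $N_a=\{\frac{j}{a_{-1}\cdots a_{-k}}: j\in\mathbb Z,\ k\ge1\}\subset\mathbb Q$. Let $\mathcal U_a$ be the family of all subgroups $\frac mn\mathbb Z$ of $N_a$ with $m,n$ positive integers such that $m$ divides $a_0\cdots a_j$ for some $j\ge0$ and $n$ divides $a_{-1}\cdots a_{-k}$ for some $k\ge1$. The group of $a$-adic numbers $\Omega_a$ is the Hausdorff completion of $N_a$ with respect to the group topology having $\mathcal U_a$ as a neighbourhood basis at $0$; it is a totally disconnected locally compact abelian group. For two sequences, $a\sim b$ means $\mathcal U_a=\mathcal U_b$. *)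

(* Defs.v *)
From HB Require Import structures.
From mathcomp Require Import all_boot all_order all_algebra.
From mathcomp Require Import boolp classical_sets functions filter.
From mathcomp Require Import topology num_normedtype tvs.

Set Implicit Arguments.
Unset Strict Implicit.
Unset Printing Implicit Defensive.

Import Order.TTheory GRing.Theory Num.Theory.

Local Open Scope classical_set_scope.
Local Open Scope ring_scope.

Definition topgroup_iso (G H : topologicalZmodType) : Prop :=
  exists (f : {additive G -> H}) (g : H -> G),
    [/\ cancel f g, cancel g f, continuous f & continuous g].

(** * Hausdorff completion of a topological abelian group *)

Section CauchyFilters.
Variable G : topologicalZmodType.
Implicit Types (F : set_system G) (A B C U V : set G) (x y z : G).

Definition filter_add F F' : set_system G :=
  (fun p : G * G => p.1 + p.2) @ (F, F').

Definition filter_opp F : set_system G := -%R @ F.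

Definition cauchy_filter F : Prop :=
  ProperFilter F /\ (fun p : G * G => p.1 - p.2) @ (F, F) --> (0 : G).

Definition minimal_cauchy F : Prop :=
  cauchy_filter F /\ forall F', cauchy_filter F' -> F' `<=` F -> F `<=` F'.

Lemma filter_addP F F' A : filter_add F F' A <->
  exists B C, [/\ F B, F' C & forall x y, B x -> C y -> A (x + y)].
Proof.
split=> [[[B C] [/= FB FC] BC]|[B [C [FB FC BC]]]].
  by exists B, C; split=> // x y Bx Cy; apply: (BC (x, y)).
by exists (B, C) => //= -[x y] [/= Bx Cy]; apply: BC.
Qed.

Lemma filter_oppP F A : filter_opp F A <-> F [set x | A (- x)].
Proof. by []. Qed.

Lemma nbhs0_half U : nbhs (0 : G) U ->
  exists2 V, nbhs (0 : G) V & forall x y, V x -> V y -> U (x + y).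
Proof.
move=> U0; have := @add_continuous G (0, 0) U; rewrite /= addr0.
move=> /(_ U0) [[B C] [/= B0 C0] BC].
exists (B `&` C) => [|x y [Bx _] [_ Cy]]; first exact: filterI.
exact: (BC (x, y)).
Qed.

Lemma nbhs0_opp U : nbhs (0 : G) U -> nbhs (0 : G) [set x | U (- x)].
Proof. by move=> U0; have := @opp_continuous G 0 U; rewrite oppr0 => /(_ U0). Qed.

Lemma nbhs0_sym U : nbhs (0 : G) U ->
  exists V, [/\ nbhs (0 : G) V, V `<=` U & forall x, V x -> V (- x)].
Proof.
move=> U0; exists (U `&` [set x | U (- x)]); split=> [|x []//|x [/= ? ?]].
  by apply: filterI => //; apply: nbhs0_opp.
by split=> //=; rewrite opprK.
Qed.

Lemma nbhs0_split U : nbhs (0 : G) U ->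
  exists V, [/\ nbhs (0 : G) V, V `<=` U, forall x, V x -> V (- x) &
    forall x y, V x -> V y -> U (x + y)].
Proof.
move=> U0; have [V V0 VU] := nbhs0_half U0.
have [W [W0 WUV WN]] := nbhs0_sym (filterI U0 V0).
exists W; split=> // [x /WUV[]//|x y /WUV[_ Vx] /WUV[_ Vy]].
exact: VU.
Qed.

Lemma nbhs_shift x A : nbhs x A <-> nbhs (0 : G) [set u | A (x + u)].
Proof.
have tr (a b : G) (B : set G) : nbhs (a + b) B -> nbhs b [set u | B (a + u)].
  move=> nB; have : (fun u : G => a + u) @ b --> a + b.
    apply: (@continuous_comp _ _ _ (fun u => (a, u)) (fun p : G * G => p.1 + p.2)).
      by apply: cvg_pair => /=; [exact: cvg_cst|exact: cvg_id].
    exact: add_continuous.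
  by apply.
split=> [nA|n0]; first by apply: tr; rewrite addr0.
have := tr (- x) x [set u | A (x + u)]; rewrite addNr => /(_ n0).
by apply: filterS => u /=; rewrite addrA subrr add0r.
Qed.

Lemma cauchy_filterP F : cauchy_filter F <-> ProperFilter F /\
  forall U, nbhs (0 : G) U -> exists2 A, F A & forall x y, A x -> A y -> U (x - y).
Proof.
split=> -[PF FF]; split=> // U U0.
  have [[B C] [/= FB FC] BC] := FF _ U0.
  exists (B `&` C) => [|x y [Bx _] [_ Cy]]; first exact: filterI.
  exact: (BC (x, y)).
by have [A FA AU] := FF _ U0; exists (A, A) => //= -[x y] [/= Ax Ay]; apply: AU.
Qed.

Lemma filter_add_proper F F' : ProperFilter F -> ProperFilter F' ->
  ProperFilter (filter_add F F').
Proof. by move=> PF PF'; exact: fmap_proper_filter. Qed.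

Lemma filter_addA F1 F2 F3 : Filter F1 -> Filter F2 -> Filter F3 ->
  filter_add F1 (filter_add F2 F3) = filter_add (filter_add F1 F2) F3.
Proof.
move=> FF1 FF2 FF3; apply/seteqP; split=> A /filter_addP.
  move=> [B [C [FB /filter_addP[D [E [FD FE DE]]] BC]]].
  apply/filter_addP; exists [set z | exists x y, [/\ B x, D y & z = x + y]], E.
  split=> // [|_ z [x [y [Bx Dy ->]]] Ez].
    by apply/filter_addP; exists B, D; split=> // x y Bx Dy; exists x, y.
  by rewrite -addrA; apply: BC => //; apply: DE.
move=> [B [C [/filter_addP[D [E [FD FE DE]]] FC BC]]].
apply/filter_addP; exists D, [set z | exists x y, [/\ E x, C y & z = x + y]].
split=> // [|z _ Dz [x [y [Ex Cy ->]]]].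
  by apply/filter_addP; exists E, C; split=> // x y Ex Cy; exists x, y.
by rewrite addrA; apply: BC => //; apply: DE.
Qed.

Lemma filter_addC F1 F2 : filter_add F1 F2 = filter_add F2 F1.
Proof.
by apply/seteqP; split=> A /filter_addP[B [C [FB FC BC]]];
  apply/filter_addP; exists C, B; split=> // x y Cx By; rewrite addrC; apply: BC.
Qed.

Lemma filter_add0_sub F : Filter F -> filter_add F (nbhs (0 : G)) `<=` F.
Proof.
move=> FF A /filter_addP[B [C [FB C0 BC]]]; apply: filterS FB => x Bx.
by rewrite -[x]addr0; apply: BC => //; apply: nbhs_singleton C0.
Qed.

Lemma cauchy_add F F' : cauchy_filter F -> cauchy_filter F' ->
  cauchy_filter (filter_add F F').
Proof.
move=> /cauchy_filterP[PF FF] /cauchy_filterP[PF' FF'].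
apply/cauchy_filterP; split; first exact: filter_add_proper.
move=> U /nbhs0_half[V V0 VU]; have [A FA AV] := FF _ V0.
have [B FB BV] := FF' _ V0.
exists [set z | exists x y, [/\ A x, B y & z = x + y]].
  by apply/filter_addP; exists A, B; split=> // x y Ax By; exists x, y.
move=> _ _ [x [y [Ax By ->]]] [z [t [Az Bt ->]]].
by rewrite opprD addrACA; apply: VU; [apply: AV|apply: BV].
Qed.

Lemma cauchy_opp F : cauchy_filter F -> cauchy_filter (filter_opp F).
Proof.
move=> /cauchy_filterP[PF FF]; apply/cauchy_filterP; split.
  exact: fmap_proper_filter.
move=> U /nbhs0_opp/FF[A FA AU]; exists [set x | A (- x)].
  by apply/filter_oppP; apply: filterS FA => x /=; rewrite opprK.
by move=> x y Ax Ay; have := AU _ _ Ax Ay; rewrite /= -opprD opprK.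
Qed.

Lemma cauchy_nbhs x : cauchy_filter (nbhs x).
Proof.
apply/cauchy_filterP; split=> [|U U0]; first exact: nbhs_pfilter.
have [V [V0 _ VN VU]] := nbhs0_split U0.
exists [set y | V (y - x)].
  by apply/nbhs_shift; apply: filterS V0 => y /=; rewrite addrC addKr.
move=> y z /= Vy Vz; rewrite -[y - z](subrKA x); apply: VU => //.
by rewrite -opprB; apply: VN.
Qed.

Lemma minimal_cauchyP F : minimal_cauchy F <->
  cauchy_filter F /\ filter_add F (nbhs (0 : G)) = F.
Proof.
split=> -[CF mF]; split=> //.
  apply/seteqP; split; first by case: CF => PF _; apply: filter_add0_sub.
  apply: mF; first exact: cauchy_add CF (cauchy_nbhs (0 : G)).
  by case: CF => PF _; apply: filter_add0_sub.
move=> F' /cauchy_filterP[PF' FF'] F'F A.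
rewrite -{1}mF => /filter_addP[B [U [FB U0 BU]]].
have [C FC CU] := FF' _ (nbhs0_opp U0).
case: CF => PF _; have [x [Bx Cx]] := filter_ex (filterI FB (F'F _ FC)).
apply: filterS FC => y Cy; rewrite -(subrKC x y).
by apply: BU => //; have := CU _ _ Cx Cy; rewrite /= opprB.
Qed.

Lemma minimal_cauchy_nbhs x : minimal_cauchy (nbhs x).
Proof.
apply/minimal_cauchyP; split; first exact: cauchy_nbhs.
apply/seteqP; split; first exact: filter_add0_sub.
move=> A /nbhs_shift/nbhs0_half[V V0 VA]; apply/filter_addP.
exists [set y | V (y - x)], V; split=> // [|y u /= Vy Vu].
  by apply/nbhs_shift; apply: filterS V0 => y /=; rewrite addrC addKr.
by have := VA _ _ Vy Vu; rewrite /= addrA subrKC.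
Qed.

Lemma minimal_cauchy_add F F' : minimal_cauchy F -> minimal_cauchy F' ->
  minimal_cauchy (filter_add F F').
Proof.
move=> /minimal_cauchyP[CF mF] /minimal_cauchyP[CF' mF'].
apply/minimal_cauchyP; split; first exact: cauchy_add.
case: CF CF' => [PF _] [PF' _].
by rewrite -filter_addA mF'.
Qed.

Lemma minimal_cauchy_opp F : minimal_cauchy F -> minimal_cauchy (filter_opp F).
Proof.
move=> /minimal_cauchyP[CF mF].
apply/minimal_cauchyP; split; first exact: cauchy_opp.
have [PF _] := CF; have [PNF _] := cauchy_opp CF.
apply/seteqP; split; first exact: filter_add0_sub.
move=> A /filter_oppP; rewrite -{1}mF => /filter_addP[B [U [FB U0 BU]]].
apply/filter_addP; exists [set x | B (- x)], [set x | U (- x)]; split.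
- by apply/filter_oppP; apply: filterS FB => x /=; rewrite opprK.
- exact: nbhs0_opp.
- by move=> x y /= Bx Uy; have := BU _ _ Bx Uy; rewrite /= -opprD opprK.
Qed.

Lemma minimal_cauchy_addN F : minimal_cauchy F ->
  filter_add F (filter_opp F) = nbhs (0 : G).
Proof.
move=> mF; have [mN sN] := minimal_cauchy_nbhs (0 : G).
have [CF _] := minimal_cauchy_add mF (minimal_cauchy_opp mF).
have sub : nbhs (0 : G) `<=` filter_add F (filter_opp F).
  move=> U; case: mF => /cauchy_filterP[PF FF] _ /FF[A FA AU].
  apply/filter_addP; exists A, [set x | A (- x)]; split=> //.
    by apply/filter_oppP; apply: filterS FA => x /=; rewrite opprK.
  by move=> x y Ax Ay; have := AU _ _ Ax Ay; rewrite opprK.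
apply/seteqP; split=> //.
have [_ mS] := minimal_cauchy_add mF (minimal_cauchy_opp mF).
exact: mS.
Qed.

End CauchyFilters.

(* Bourbaki's construction (General Topology, II.3.7): the points of the
   Hausdorff completion are the minimal Cauchy filters, and X, Y are V-close
   when they share a V-small set. [completion_mapP] below checks the defining
   properties. *)
Record completion (G : topologicalZmodType) := Completion {
  cfilter : set_system G;
  cfilter_minimal : minimal_cauchy cfilter }.

HB.instance Definition _ (G : topologicalZmodType) :=
  gen_eqMixin (completion G).
HB.instance Definition _ (G : topologicalZmodType) :=
  gen_choiceMixin (completion G).

Section Completion.
Variable G : topologicalZmodType.
Implicit Types (X Y Z : completion G) (A B U V : set G).

Lemma completionE X Y : cfilter X = cfilter Y -> X = Y.
Proof.
case: X Y => [F mF] [F' mF'] /= FF'; move: mF mF'; rewrite FF' => mF mF'.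
by congr Completion; apply: Prop_irrelevance.
Qed.

Lemma cfilter_proper X : ProperFilter (cfilter X).
Proof. by case: (cfilter_minimal X) => -[]. Qed.
#[local] Existing Instance cfilter_proper.

Lemma cfilter_round X : filter_add (cfilter X) (nbhs (0 : G)) = cfilter X.
Proof. by have /minimal_cauchyP[] := cfilter_minimal X. Qed.

Definition completion_map (x : G) : completion G :=
  Completion (minimal_cauchy_nbhs x).

Definition completion_add X Y : completion G :=
  Completion (minimal_cauchy_add (cfilter_minimal X) (cfilter_minimal Y)).

Definition completion_opp X : completion G :=
  Completion (minimal_cauchy_opp (cfilter_minimal X)).

Lemma completion_addA : associative completion_add.
Proof. by move=> X Y Z; apply: completionE; apply: filter_addA. Qed.

Lemma completion_addC : commutative completion_add.
Proof. by move=> X Y; apply: completionE; apply: filter_addC. Qed.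

Lemma completion_add0 : left_id (completion_map 0) completion_add.
Proof.
by move=> X; apply: completionE; rewrite /= filter_addC; apply: cfilter_round.
Qed.

Lemma completion_addN :
  left_inverse (completion_map 0) completion_opp completion_add.
Proof.
move=> X; apply: completionE; rewrite /= filter_addC.
exact: minimal_cauchy_addN (cfilter_minimal X).
Qed.

HB.instance Definition _ := GRing.isZmodule.Build (completion G)
  completion_addA completion_addC completion_add0 completion_addN.

Definition completion_entourage V X Y : Prop :=
  exists A, [/\ cfilter X A, cfilter Y A & forall x y, A x -> A y -> V (x - y)].

Definition completion_nbhs X : set_system (completion G) :=
  [set W | exists2 V, nbhs (0 : G) V &
     forall Y, completion_entourage V X Y -> W Y].

HB.instance Definition _ := hasNbhs.Build (completion G) completion_nbhs.

Lemma completion_subP X Y V : cfilter (X - Y) V <->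
  exists A B, [/\ cfilter X A, cfilter Y B & forall x y, A x -> B y -> V (x - y)].
Proof.
split=> [/filter_addP[A [B [XA YB AB]]]|[A [B [XA YB AB]]]].
  exists A, [set y | B (- y)]; split=> // x y Ax By; exact: AB.
apply/filter_addP; exists A, [set y | B (- y)]; split=> //.
  by apply/filter_oppP; apply: filterS YB => y /=; rewrite opprK.
by move=> x y Ax By; have := AB _ _ Ax By; rewrite opprK.
Qed.

Lemma cfilter_small X U : nbhs (0 : G) U ->
  exists2 A, cfilter X A & forall x y, A x -> A y -> U (x - y).
Proof. by case: (cfilter_minimal X) => /cauchy_filterP[_ H] _; apply: H. Qed.

Lemma completion_nbhsP X W : nbhs X W <->
  exists2 V, nbhs (0 : G) V & forall Y, cfilter (Y - X) V -> W Y.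
Proof.
split=> -[V V0 VW].
  have [S [S0 SV SN]] := nbhs0_sym V0.
  exists S => // Y /completion_subP[A [B [YA XB AB]]]; apply: VW.
  have [A' YA' A'S] := cfilter_small Y S0.
  have [B' XB' B'S] := cfilter_small X S0.
  exists ((A `&` A') `|` (B `&` B')); split.
  - by apply: filterS (filterI XB XB') => x; right.
  - by apply: filterS (filterI YA YA') => x; left.
  - move=> x y [[Ax A'x]|[Bx B'x]] [[Ay A'y]|[By B'y]]; apply: SV.
    + exact: A'S.
    + exact: AB.
    + by rewrite -opprB; apply: SN; apply: AB.
    + exact: B'S.
exists V => // Y [A [XA YA AV]]; apply: VW.
by apply/completion_subP; exists A, A.
Qed.

Lemma completion_sub_add X Y Z U V :
  (forall x y, U x -> U y -> V (x + y)) ->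
  cfilter (X - Y) U -> cfilter (Y - Z) U -> cfilter (X - Z) V.
Proof.
move=> UV XYU YZU; rewrite -(subrKA Y); apply/filter_addP.
by exists U, U.
Qed.

Lemma completion_subC X Y V :
  cfilter (X - Y) V -> cfilter (Y - X) [set x | V (- x)].
Proof.
move=> /completion_subP[A [B [XA YB AB]]]; apply/completion_subP.
by exists B, A; split=> // x y Bx Ay; rewrite /= opprB; apply: AB.
Qed.

Lemma completion_nbhs_filter X : ProperFilter (nbhs X).
Proof.
split=> [/completion_nbhsP[V V0 /(_ X)]|].
  by apply; rewrite subrr.
split.
- by apply/completion_nbhsP; exists setT => //; exact: filterT.
- move=> W W' /completion_nbhsP[V V0 VW] /completion_nbhsP[V' V'0 VW'].
  apply/completion_nbhsP; exists (V `&` V'); first exact: filterI.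
  by move=> Y YXV; split; [apply: VW|apply: VW']; apply: filterS YXV => x [].
- move=> W W' WW' /completion_nbhsP[V V0 VW]; apply/completion_nbhsP.
  by exists V => // Y /VW/WW'.
Qed.

Lemma completion_nbhs_singleton X (W : set (completion G)) : nbhs X W -> W X.
Proof. by move=> /completion_nbhsP[V V0]; apply; rewrite subrr. Qed.

Lemma completion_nbhs_nbhs X (W : set (completion G)) :
  nbhs X W -> nbhs X (nbhs^~ W).
Proof.
move=> /completion_nbhsP[V /nbhs0_half[S S0 SV] VW].
apply/completion_nbhsP; exists S => // Y YXS; apply/completion_nbhsP.
by exists S => // Z ZYS; apply: VW; apply: completion_sub_add SV ZYS YXS.
Qed.

HB.instance Definition _ := Nbhs_isNbhsTopological.Build (completion G)
  completion_nbhs_filter completion_nbhs_singleton completion_nbhs_nbhs.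

Lemma completion_sub_continuous :
  continuous (fun p : completion G * completion G => p.1 - p.2).
Proof.
move=> [X Y] W /= /completion_nbhsP[V V0 VW].
have [S [S0 _ SN SV]] := nbhs0_split V0.
exists ([set X' | cfilter (X' - X) S], [set Y' | cfilter (Y' - Y) S]) => /=.
  by split; apply/completion_nbhsP; exists S.
move=> [X' Y'] [/= X'S Y'S]; apply: VW.
have -> : (X', Y').1 - (X', Y').2 - ((X, Y).1 - (X, Y).2) = (X' - X) + (Y - Y').
  by rewrite /= opprB [Y - X]addrC addrACA [- Y' + Y]addrC.
apply/filter_addP; exists S, S; split=> //.
by move/completion_subC: Y'S; apply: filterS => x /SN; rewrite opprK.
Qed.

HB.instance Definition _ := PreTopologicalNmodule_isTopologicalZmodule.Build
  (completion G) completion_sub_continuous.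

Lemma completion_map_is_zmod_morphism : zmod_morphism completion_map.
Proof.
move=> x y; apply: completionE.
have sub : nbhs (x - y) `<=` cfilter (completion_map x - completion_map y).
  move=> A nA; have := @sub_continuous G (x, y) A nA.
  move=> [[B C] [xB yC] BC]; apply/completion_subP; exists B, C; split=> //.
  by move=> u v Bu Cv; apply: (BC (u, v)).
apply/seteqP; split=> //.
have [_] := cfilter_minimal (completion_map x - completion_map y); apply=> //.
exact: cauchy_nbhs.
Qed.

HB.instance Definition _ := GRing.isZmodMorphism.Build G (completion G)
  completion_map completion_map_is_zmod_morphism.

Lemma completion_hausdorff : hausdorff_space (completion G).
Proof.
move=> X Y XY; apply/eqP; rewrite -subr_eq0; apply/eqP/completionE/esym.
have sub : nbhs (0 : G) `<=` cfilter (X - Y).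
  move=> V V0; have [S [S0 _ SN SV]] := nbhs0_split V0.
  have nX : nbhs X [set Z | cfilter (Z - X) S] by apply/completion_nbhsP; exists S.
  have nY : nbhs Y [set Z | cfilter (Z - Y) S] by apply/completion_nbhsP; exists S.
  have [Z [/= ZX ZY]] := XY _ _ nX nY.
  apply: completion_sub_add SV _ ZY.
  by move/completion_subC: ZX; apply: filterS => x /SN; rewrite opprK.
apply/seteqP; split=> //.
by have [_] := cfilter_minimal (X - Y); apply=> //; apply: cauchy_nbhs.
Qed.

Lemma completion_complete (F : set_system (completion G)) :
  cauchy_filter F -> exists X, F --> X.
Proof.
move=> /cauchy_filterP[PF CF].
pose E : set_system G := [set A | exists B V,
  [/\ nbhs (0 : G) V, forall x u, B x -> V u -> A (x + u) &
      F [set X | cfilter X B]]].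
have key U : nbhs (0 : G) U -> exists B V W, [/\ nbhs (0 : G) V, F W,
    forall X, W X -> cfilter X B &
    forall x y u v, B x -> B y -> V u -> V v -> U ((x + u) - (y + v))].
  move=> U0; have [S [S0 _ SN SU]] := nbhs0_split U0.
  have [T [T0 TS TN TT]] := nbhs0_split S0.
  have [V [V0 VT VN VV]] := nbhs0_split T0.
  have nV : nbhs (0 : completion G) [set Z | cfilter Z V].
    by apply/completion_nbhsP; exists V => // Y; rewrite subr0.
  have [W FW WV] := CF _ nV; have [X0 WX0] := filter_ex FW.
  have [B XB BV] := cfilter_small X0 V0.
  exists [set z | exists b s, [/\ B b, V s & z = b + s]], V, W; split=> //.
    move=> X WX; have /completion_subP[C [D [XC XD CD]]] := WV _ _ WX WX0.
    have [d [Dd Bd]] := filter_ex (filterI XD XB).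
    apply: filterS XC => c Cc; exists d, (c - d); split=> //; first exact: CD.
    by rewrite subrKC.
  move=> _ _ u v [b [s [Bb Vs ->]]] [c [t [Bc Vt ->]]] Vu Vv.
  have -> : b + s + u - (c + t + v) = ((b - c) + (s - t)) + (u - v).
    by rewrite !opprD addrACA [b + s + _]addrACA.
  apply: SU; last by apply: TS; apply: VV => //; exact: VN.
  apply: TT; first by apply: VT; exact: BV.
  by apply: VV => //; exact: VN.
have PE : ProperFilter E.
  split=> [[B [V [V0 BV]]] /filter_ex[X /= XB]|].
    have [x Bx] := filter_ex XB.
    exact: (BV x 0 Bx (nbhs_singleton V0)).
  split.
  - exists setT, setT; split=> //; first exact: filterT.
    by apply: filterS filterT => X _; exact: filterT.
  - move=> A A' [B [V [V0 BV FB]]] [B' [V' [V'0 BV' FB']]].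
    exists (B `&` B'), (V `&` V'); split=> //; first exact: filterI.
      by move=> x u [Bx B'x] [Vu V'u]; split; [exact: BV|exact: BV'].
    by apply: filterS (filterI FB FB') => X [? ?]; exact: filterI.
  - move=> A A' AA' [B [V [V0 BV FB]]]; exists B, V; split=> // x u Bx Vu.
    by apply: AA'; exact: BV.
have mE : minimal_cauchy E.
  apply/minimal_cauchyP; split.
    apply/cauchy_filterP; split=> // U /key[B [V [W [V0 FW WB BU]]]].
    exists [set z | exists x u, [/\ B x, V u & z = x + u]].
      exists B, V; split=> // [x u Bx Vu|]; first by exists x, u.
      by apply: filterS FW => X /WB.
    by move=> _ _ [x [u [Bx Vu ->]]] [y [v [By Vv ->]]]; exact: BU.
  apply/seteqP; split; first exact: filter_add0_sub.
  move=> A [B [V [/nbhs0_half[S S0 SV] BV FB]]]; apply/filter_addP.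
  exists [set z | exists x u, [/\ B x, S u & z = x + u]], S; split=> //.
    by exists B, S; split=> // x u Bx Su; exists x, u.
  by move=> _ v [x [u [Bx Su ->]]] Sv; rewrite -addrA; apply: BV => //; exact: SV.
exists (Completion mE) => W /completion_nbhsP[U U0 UW].
have [B [V [W' [V0 FW' W'B BU]]]] := key U U0.
apply: filterS (FW') => X /W'B XB; apply: UW; apply/completion_subP => /=.
exists B, [set z | exists x u, [/\ B x, V u & z = x + u]]; split=> //.
  exists B, V; split=> // [x u Bx Vu|]; first by exists x, u.
  by apply: filterS FW' => Y /W'B.
move=> x _ Bx [y [v [By Vv ->]]].
by have := BU _ _ _ _ Bx By (nbhs_singleton V0) Vv; rewrite addr0.
Qed.

Lemma completion_map_dense : dense (range completion_map).
Proof.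
move=> O [X OX] oO; have /completion_nbhsP[V V0 VO] := open_nbhs_nbhs (conj oO OX).
have [S [S0 _ SN SV]] := nbhs0_split V0.
have [A XA AS] := cfilter_small X S0; have [x Ax] := filter_ex XA.
exists (completion_map x); split; last by exists x.
apply: VO; apply/completion_subP; exists [set y | S (y - x)], A; split=> //=.
  by apply/nbhs_shift; apply: filterS S0 => y /=; rewrite addrC addKr.
by move=> y z Sy Az; rewrite -[y - z](subrKA x); apply: SV => //; exact: AS.
Qed.

Lemma completion_map_initial (x : G) A :
  nbhs x A <-> exists2 W, nbhs (completion_map x) W & completion_map @^-1` W `<=` A.
Proof.
split=> [/nbhs_shift xA|[W /completion_nbhsP[V V0 VW] WA]].
  exists [set Y | cfilter (Y - completion_map x) [set u | A (x + u)]].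
    by apply/completion_nbhsP; exists [set u | A (x + u)].
  move=> y /completion_subP[B [C [yB xC BC]]].
  have := BC _ _ (nbhs_singleton yB) (nbhs_singleton xC).
  by rewrite /= subrKC.
have [S [S0 SV SN SS]] := nbhs0_split V0.
have [T [T0 _ TN TS]] := nbhs0_split S0.
apply/nbhs_shift; apply: filterS (T0) => u Tu; apply: WA; apply: VW.
rewrite -raddfB addrC addKr.
apply: (@filterS _ _ _ [set y | T (y - u)]).
  move=> y Ty; apply: SV; rewrite -(subrK u y); exact: TS.
apply/nbhs_shift; apply: filterS (T0) => y /=; by rewrite addrC addKr.
Qed.

End Completion.

Definition is_hausdorff_completion (G H : topologicalZmodType) (i : G -> H) :=
  [/\ zmod_morphism i, hausdorff_space H,
      forall F : set_system H, cauchy_filter F -> exists x : H, F --> x,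
      dense (range i) &
      forall (x : G) (A : set G),
        nbhs x A <-> exists2 W, nbhs (i x) W & i @^-1` W `<=` A].

Theorem completion_mapP (G : topologicalZmodType) :
  is_hausdorff_completion (@completion_map G).
Proof.
split; [exact: completion_map_is_zmod_morphism|exact: completion_hausdorff|
  exact: completion_complete|exact: completion_map_dense|].
exact: completion_map_initial.
Qed.

(** * The group of a-adic numbers *)

(* prod_left a k = a_(-1) ... a_(-k) and prod_right a j = a_0 ... a_j. *)
Definition prod_left (a : int -> nat) (k : nat) : nat :=
  \prod_(1 <= i < k.+1) a (- i%:Z).

Definition prod_right (a : int -> nat) (j : nat) : nat :=
  \prod_(0 <= i < j.+1) a i%:Z.

Definition Nset (a : int -> nat) : set rat :=
  [set x | exists (j : int) (k : nat),
     (1 <= k)%N /\ x = j%:~R / (prod_left a k)%:R].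

(* The subgroup (m/n)Z of the rationals. *)
Definition fracZ (m n : nat) : set rat :=
  [set x | exists z : int, x = z%:~R * (m%:R / n%:R)].

Definition Ufam (a : int -> nat) : set (set rat) :=
  [set H | H `<=` Nset a /\
     exists m n : nat, [/\ (0 < m)%N, (0 < n)%N,
       exists j, (m %| prod_right a j)%N,
       exists2 k, (1 <= k)%N & (n %| prod_left a k)%N &
       H = fracZ m n]].

Definition seq_sim (a b : int -> nat) : Prop := Ufam a = Ufam b.

Record seq_ge2 := SeqGe2 {
  seq_fun :> int -> nat;
  seq_fun_ge2 : forall i, (2 <= seq_fun i)%N }.

Record Ngrp (a : seq_ge2) := MkN { Nval : rat; _ : Nval \in Nset a }.

HB.instance Definition _ a := [isSub for @Nval a].
HB.instance Definition _ a := [Choice of Ngrp a by <:].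

Section NTopology.
Variable a : seq_ge2.
Implicit Types (x y : Ngrp a) (U V W : set rat) (A : set (Ngrp a)).

Lemma prod_left_neq0 k : (prod_left a k)%:R != 0 :> rat.
Proof.
rewrite pnatr_eq0 -lt0n /prod_left; apply: prodn_gt0 => i.
exact: leq_trans (seq_fun_ge2 a _).
Qed.

Lemma prod_left_dvd k l : (k <= l)%N -> (prod_left a k %| prod_left a l)%N.
Proof.
move=> kl; rewrite /prod_left [X in (_ %| X)%N](@big_cat_nat _ _ _ k.+1) //=.
exact: dvdn_mulr.
Qed.

Lemma prod_right_dvd k l : (k <= l)%N -> (prod_right a k %| prod_right a l)%N.
Proof.
move=> kl; rewrite /prod_right [X in (_ %| X)%N](@big_cat_nat _ _ _ k.+1) //=.
exact: dvdn_mulr.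
Qed.

Lemma NsetB (r s : rat) : Nset a r -> Nset a s -> Nset a (r - s).
Proof.
move=> [j [k [k1 ->]]] [j' [k' [k'1 ->]]].
have /dvdnP[c cE] := prod_left_dvd (leq_maxl k k').
have /dvdnP[d dE] := prod_left_dvd (leq_maxr k k').
have P0 := prod_left_neq0 (maxn k k').
exists (j * c%:Z - j' * d%:Z), (maxn k k').
split; first by rewrite leq_max k1.
rewrite rmorphB mulrBl; congr (_ - _).
- have c0 : c%:R != 0 :> rat.
    by move: P0; rewrite cE natrM mulf_eq0 negb_or => /andP[].
  by rewrite [in RHS]cE mulnC rmorphM natrM /= -pmulrn -mulf_div divff ?mulr1.
- have d0 : d%:R != 0 :> rat.
    by move: P0; rewrite dE natrM mulf_eq0 negb_or => /andP[].
  by rewrite [in RHS]dE mulnC rmorphM natrM /= -pmulrn -mulf_div divff ?mulr1.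
Qed.

Lemma Nset_int (z : int) : Nset a z%:~R.
Proof.
exists (z * (prod_left a 1)%:Z), 1; split=> //.
by rewrite rmorphM /= -pmulrn mulfK ?prod_left_neq0.
Qed.

Lemma Nset_zmod_closed : zmod_closed (fun r : rat => r \in Nset a).
Proof.
split=> [|r s]; first exact/mem_set/(Nset_int 0).
by rewrite !unfold_in => /asboolP Nr /asboolP Ns; apply/asboolP/NsetB.
Qed.

HB.instance Definition _ := GRing.SubChoice_isSubZmodule.Build rat _ (Ngrp a)
  Nset_zmod_closed.

Definition N_nbhs x : set_system (Ngrp a) :=
  [set A | exists2 U, Ufam a U & forall y, U (val y - val x) -> A y].

HB.instance Definition _ := hasNbhs.Build (Ngrp a) N_nbhs.

Lemma Ufam0 U : Ufam a U -> U 0.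
Proof. by move=> [_ [m [n [_ _ _ _ ->]]]]; exists 0; rewrite mul0r. Qed.

Lemma UfamB U r s : Ufam a U -> U r -> U s -> U (r - s).
Proof.
move=> [_ [m [n [_ _ _ _ ->]]]] [z ->] [t ->].
by exists (z - t); rewrite rmorphB mulrBl.
Qed.

Lemma UfamD U r s : Ufam a U -> U r -> U s -> U (r + s).
Proof.
move=> aU Ur Us; rewrite -[s]opprK -[- s]sub0r; apply: UfamB => //.
by apply: UfamB => //; exact: Ufam0.
Qed.

Lemma Ufam_int (m j : nat) : (0 < m)%N -> (m %| prod_right a j)%N ->
  Ufam a (fracZ m 1).
Proof.
move=> m0 mj; split.
  move=> _ [z ->]; rewrite divr1 pmulrn -rmorphM; exact: Nset_int.
by exists m, 1; split=> //; [exists j|exists 1].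
Qed.

Lemma UfamI U V : Ufam a U -> Ufam a V ->
  exists2 W, Ufam a W & W `<=` U `&` V.
Proof.
move=> [_ [m [n [m0 n0 [j mj] _ ->]]]] [_ [m' [n' [m'0 n'0 [j' mj'] _ ->]]]].
have sub (c d e : nat) : (c %| d)%N -> (0 < e)%N -> fracZ d 1 `<=` fracZ c e.
  move=> /dvdnP[q ->] e0 _ [z ->]; exists (z * (q * e)%:Z).
  have e0' : e%:R != 0 :> rat by rewrite pnatr_eq0 -lt0n.
  rewrite divr1 [in RHS]rmorphM /= -[in RHS]mulrA; congr (_ * _).
  by rewrite -pmulrn !natrM mulrACA mulfV // mulr1.
exists (fracZ (lcmn m m') 1); last first.
  by move=> r W; split; move: W; apply: sub => //;
    [exact: dvdn_lcml|exact: dvdn_lcmr].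
apply: (@Ufam_int _ (maxn j j')); first by rewrite lcmn_gt0 m0.
rewrite dvdn_lcm (dvdn_trans mj (prod_right_dvd (leq_maxl _ _))).
exact: dvdn_trans mj' (prod_right_dvd (leq_maxr _ _)).
Qed.

Lemma N_nbhs_filter x : ProperFilter (nbhs x).
Proof.
split=> [[U aU /(_ x)]|].
  by apply; rewrite subrr; exact: Ufam0.
split.
- by exists (fracZ 1 1) => //; exact: (@Ufam_int 1 0).
- move=> A B [U aU UA] [V aV VB]; have [W aW WUV] := UfamI aU aV.
  by exists W => // y /WUV[/UA ? /VB ?].
- by move=> A B AB [U aU UA]; exists U => // y /UA/AB.
Qed.

Lemma N_nbhs_singleton x A : nbhs x A -> A x.
Proof. by move=> [U aU]; apply; rewrite subrr; exact: Ufam0. Qed.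

Lemma N_nbhs_nbhs x A : nbhs x A -> nbhs x (nbhs^~ A).
Proof.
move=> [U aU UA]; exists U => // y Uy; exists U => // z Uz.
by apply: UA; rewrite -(subrKA (val y)); exact: UfamD.
Qed.

HB.instance Definition _ := Nbhs_isNbhsTopological.Build (Ngrp a)
  N_nbhs_filter N_nbhs_singleton N_nbhs_nbhs.

Lemma N_sub_continuous : continuous (fun p : Ngrp a * Ngrp a => p.1 - p.2).
Proof.
move=> [x y] A [U aU UA].
exists ([set z | U (val z - val x)], [set z | U (val z - val y)]).
  by split; exists U.
move=> [z t] [/= Uz Ut]; apply: UA.
suff -> : val (z - t) - val (x - y) = (val z - val x) - (val t - val y).
  exact: UfamB.
by rewrite !raddfB /= !opprK addrACA.
Qed.

HB.instance Definition _ := PreTopologicalNmodule_isTopologicalZmodule.Build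
  (Ngrp a) N_sub_continuous.

End NTopology.

Definition Omega (a : seq_ge2) : topologicalZmodType := completion (Ngrp a).

(* The sequence a with a_(-1) multiplied by q and a_0 multiplied by p. *)
Definition rescale (q p : nat) (a : int -> nat) : int -> nat := fun i =>
  if i == -1 then (q * a i)%N else if i == 0 then (p * a i)%N else a i.

(* Main.v *)
(* Multiplication by p/q maps N_a onto N_b and matches the two topologies
   exactly when, as supernatural numbers, q * (a_(-1) a_(-2) ...) =
   p * (b_(-1) b_(-2) ...) and p * (a_0 a_1 ...) = q * (b_0 b_1 ...), which is
   what U_a' = U_b' says.  Conversely, let f be an isomorphism and K the closure
   of Z in Omega_a.  Then f(K) is open, and it meets N_b in a subgroup (p/q)Z.
   The orders of the elements 1/l in Omega_a/K = N_a/Z and in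
   Omega_b/f(K) = N_b/(p/q)Z give the first equality, and the open subgroups of
   K and f(K) give the second one. *)
From HB Require Import structures.
Require Import Defs.
From mathcomp Require Import all_boot all_order all_algebra.
From mathcomp Require Import boolp classical_sets topology tvs.
From mathcomp Require Import functions filter ring.

Set Implicit Arguments.
Unset Strict Implicit.
Unset Printing Implicit Defensive.

Import Order.TTheory GRing.Theory Num.Theory.

Local Open Scope classical_set_scope.
Local Open Scope ring_scope.

(** * Subgroups of abelian groups and of the integers *)

Definition subgroup (G : zmodType) (A : set G) : Prop :=
  A 0 /\ forall x y, A x -> A y -> A (x - y).

Section Subgroup.
Variables (G : zmodType) (A : set G).
Hypothesis sA : subgroup A.

Lemma subgroupD x y : A x -> A y -> A (x + y).
Proof.
case: sA => A0 AB Ax Ay; rewrite -[y]opprK; apply: (AB) => //.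
by rewrite -sub0r; apply: AB.
Qed.

Lemma subgroupMn x n : A x -> A (x *+ n).
Proof.
move=> Ax; elim: n => [|n IHn]; first by case: sA.
by rewrite mulrS; apply: subgroupD.
Qed.

Lemma subgroupMz x (z : int) : A x -> A (x *~ z).
Proof.
move=> Ax; case: z => n; first exact: subgroupMn.
by case: sA => A0 AB; rewrite NegzE mulrNz -sub0r; apply: AB => //; exact: subgroupMn.
Qed.

Lemma subgroup_subl x y : A (x - y) -> A y -> A x.
Proof. by move=> Axy Ay; rewrite -(subrK y x); exact: subgroupD. Qed.

Lemma subgroup_subr x y : A (x - y) -> A x -> A y.
Proof. by move=> Axy Ax; case: sA => _ AB; rewrite -(subKr x y); exact: AB. Qed.

End Subgroup.

Lemma int_subgroup (A : set int) : subgroup A -> (exists2 n : nat, (0 < n)%N & A n) ->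
  exists2 s : nat, (0 < s)%N & forall z : int, A z <-> exists t, z = t * s%:Z.
Proof.
move=> sA [n n0 An].
have ex : exists n : nat, (0 < n)%N && `[< A n >].
  by exists n; rewrite n0; apply/asboolP.
case: (ex_minnP ex) => s /andP[s0 /asboolP As] smin.
have As' t : A (t * s%:Z) by rewrite mulrC -mulrzz; exact: subgroupMz.
exists s => // z; split=> [Az|[t ->]]; last exact: As'.
have sz : s%:Z != 0 by rewrite eqz_nat -lt0n.
have := modz_ge0 z sz; have := ltz_pmod z (s0 : 0 < s%:Z).
have := divz_eq z s; case: (z %% s)%Z => // r zE rs _.
exists (z %/ s)%Z; case: r zE rs => [|r] zE; first by rewrite {1}zE addr0.
rewrite ltz_nat => rs; suff /smin : (0 < r.+1)%N && `[< A r.+1 >].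
  by rewrite leqNgt rs.
apply/asboolP; have [_ AB] := sA; have := AB _ _ Az (As' (z %/ s)%Z).
by rewrite {1}zE addrC addKr.
Qed.

(** * Closures of open subgroups in the completion *)

Section CompletionSubgroups.
Variable G : topologicalZmodType.
Implicit Types (V : set G) (X : completion G).

(* When V is an open subgroup, this is the closure of its image. *)
Definition ccl V : set (completion G) := [set X | cfilter X V].

Lemma ccl_subgroup V : nbhs (0 : G) V -> subgroup V -> subgroup (ccl V).
Proof.
move=> V0 [_ VB]; split=> // X Y XV YV.
by apply/completion_subP; exists V, V.
Qed.

Lemma ccl_sub V W : V `<=` W -> ccl V `<=` ccl W.
Proof. by move=> VW X; have := cfilter_proper X => PX; exact: filterS. Qed.

(** An open subgroup is a neighbourhood of exactly its own points. Through this trace on G,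
    membership in the completion becomes arithmetic in N_a or N_b. *)
Lemma ccl_map V x : nbhs (0 : G) V -> subgroup V -> ccl V (completion_map x) <-> V x.
Proof.
move=> V0 sV; split=> [|Vx]; first exact: nbhs_singleton.
by apply/nbhs_shift; apply: filterS V0 => u /=; exact: subgroupD.
Qed.

(** A Cauchy filter contains arbitrarily small sets, and any point of a small enough one serves as
    x. So points of the completion can be replaced by points of G modulo V. *)
Lemma ccl_dense V X : nbhs (0 : G) V -> exists x, ccl V (X - completion_map x).
Proof.
move=> /nbhs0_split[W [W0 _ WN WV]].
have [A XA AW] := cfilter_small X W0.
have PX := cfilter_proper X; have [x Ax] := filter_ex XA.
exists x; apply/completion_subP; exists A, [set y | W (y - x)]; split=> //.
  by apply/nbhs_shift; apply: filterS W0 => y /=; rewrite addrC addKr.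
move=> y z Ay Wz; rewrite -(subrKA x); apply: WV; first exact: AW.
by rewrite -opprB; exact: WN.
Qed.

Lemma nbhs_ccl (W : set (completion G)) :
  nbhs (0 : completion G) W <-> exists2 V, nbhs (0 : G) V & ccl V `<=` W.
Proof.
by split=> [/completion_nbhsP|] [V V0 VW]; [|apply/completion_nbhsP];
  exists V => // Y YV; apply: VW; move: YV; rewrite subr0.
Qed.

End CompletionSubgroups.

(** * Extending an isomorphism of topological groups to the completions *)

Section CompletionIso.
Variables (G H : topologicalZmodType) (f : {additive G -> H}) (g : {additive H -> G}).
Hypotheses (fK : cancel f g) (gK : cancel g f).
Hypotheses (fc : continuous f) (gc : continuous g).

Lemma fmapK (F : set_system G) : g @ (f @ F) = F.
Proof.
apply/funext=> A; rewrite !fmapE; congr (F _).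
by apply/funext=> x; rewrite /preimage/= fK.
Qed.

(** As g inverts f, the preimage of A under g is the image f(A); direct images are written in this
    way throughout the section. *)
Lemma fmap_preimage (F : set_system G) (A : set G) : F A -> (f @ F) (g @^-1` A).
Proof. by rewrite -{1}[F]fmapK. Qed.

Lemma minimal_cauchy_fmap (F : set_system G) :
  minimal_cauchy F -> minimal_cauchy (f @ F).
Proof.
move=> /minimal_cauchyP[/cauchy_filterP[PF CF] mF].
apply/minimal_cauchyP; split.
  apply/cauchy_filterP; split; first exact: fmap_proper_filter.
  move=> U U0; have := @fc 0 U; rewrite raddf0 => /(_ U0)/CF[A FA AU].
  exists (g @^-1` A) => [|x y /= Ax Ay]; first exact: fmap_preimage.
  by have := AU _ _ Ax Ay; rewrite /= raddfB /= !gK.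
apply/seteqP; split; first exact: filter_add0_sub.
move=> A; rewrite -{1}mF => /filter_addP[B [U [FB U0 BU]]].
apply/filter_addP; exists (g @^-1` B), (g @^-1` U); split=> /=.
- exact: fmap_preimage.
- by have := @gc 0 U; rewrite raddf0; exact.
- by move=> x y Bx Uy; have := BU _ _ Bx Uy; rewrite /= raddfD /= !gK.
Qed.

Definition completion_lift (X : completion G) : completion H :=
  Completion (minimal_cauchy_fmap (cfilter_minimal X)).

Lemma completion_lift_is_zmod_morphism : zmod_morphism completion_lift.
Proof.
move=> X Y; apply: completionE; apply/seteqP; split=> A.
  move=> /completion_subP[B [C [XB YC BC]]].
  apply/completion_subP; exists (g @^-1` B), (g @^-1` C); split=> /=.
  - exact: fmap_preimage.
  - exact: fmap_preimage.
  - by move=> x y Bx Cy; have := BC _ _ Bx Cy; rewrite /= raddfB /= !gK.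
move=> /completion_subP[B [C [XB YC BC]]].
apply/completion_subP; exists (f @^-1` B), (f @^-1` C); split=> // x y Bx Cy.
by rewrite /= raddfB; exact: BC.
Qed.

HB.instance Definition _ := GRing.isZmodMorphism.Build
  (completion G) (completion H) completion_lift completion_lift_is_zmod_morphism.

Lemma completion_lift_continuous : continuous completion_lift.
Proof.
move=> X W /= /completion_nbhsP[V V0 VW].
apply/completion_nbhsP; exists (f @^-1` V).
  by have := @fc 0 V; rewrite raddf0; exact.
by move=> Y YV; apply: VW; rewrite -raddfB.
Qed.

End CompletionIso.

Lemma completion_iso (G H : topologicalZmodType)
    (f : {additive G -> H}) (g : {additive H -> G}) :
  cancel f g -> cancel g f -> continuous f -> continuous g ->
  topgroup_iso (completion G) (completion H).
Proof.
move=> fK gK fc gc.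
exists (completion_lift fK gK fc gc), (completion_lift gK fK gc fc).
split; try exact: completion_lift_continuous.
  by move=> X; apply: completionE; exact: fmapK.
by move=> X; apply: completionE; exact: fmapK.
Qed.

(** * Divisibility, and the subgroups mZ of N_a *)

(** Divisibility is moved into the rationals so that [field] can handle the fractions below. *)
Lemma dvdn_ratP (u v : nat) : reflect (exists z : int, v%:R = z%:~R * u%:R :> rat) (u %| v)%N.
Proof.
apply: (iffP dvdnP) => [[k ->]|[z]].
  by exists k%:Z; rewrite natrM -pmulrn.
rewrite !pmulrn -rmorphM /= => /eqP; rewrite eqr_int => /eqP/(congr1 absz).
by rewrite abszM => /= ->; exists `|z|%N.
Qed.

Section NgrpMultiples.
Variable a : seq_ge2.
Implicit Types x : Ngrp a.

Lemma prod_left_gt0 k : (0 < prod_left a k)%N.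
Proof. by apply: prodn_gt0 => i; exact: leq_trans (seq_fun_ge2 a _). Qed.

Lemma prod_right_gt0 j : (0 < prod_right a j)%N.
Proof. by apply: prodn_gt0 => i; exact: leq_trans (seq_fun_ge2 a _). Qed.

Lemma Ngrp_elt (z : int) k :
  exists x : Ngrp a, val x = z%:~R / (prod_left a k.+1)%:R.
Proof.
have Nz : Nset a (z%:~R / (prod_left a k.+1)%:R) by exists z, k.+1.
by exists (MkN (mem_set Nz)).
Qed.

Lemma Ngrp_int (z : int) : exists x : Ngrp a, val x = z%:~R.
Proof. by exists (MkN (mem_set (Nset_int a z))). Qed.

Lemma Ngrp_frac x :
  exists (z : int) k, val x = z%:~R / (prod_left a k.+1)%:R.
Proof. by case: x => r /= /set_mem[z [[|k] [//= _ ->]]]; exists z, k. Qed.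

(** The subgroup mZ of N_a; the closure of [Nmult 1] is the group K of the overview. *)
Definition Nmult (m : nat) : set (Ngrp a) :=
  [set x | exists z : int, val x = z%:~R * m%:R].

Lemma Nmult_subgroup m : subgroup (Nmult m).
Proof.
split=> [|x y [z xE] [t yE]]; first by exists 0; rewrite raddf0 mul0r.
by exists (z - t); rewrite raddfB /= xE yE rmorphB mulrBl.
Qed.

Lemma nbhs_Nmult m j : (m %| prod_right a j)%N -> nbhs (0 : Ngrp a) (Nmult m).
Proof.
move=> mj; exists (fracZ m 1).
  by apply: Ufam_int (mj); exact: dvdn_gt0 (prod_right_gt0 j) mj.
by move=> y; rewrite raddf0 subr0 => -[z yE]; exists z; rewrite yE divr1.
Qed.

(** A basic subgroup (m/n)Z contains mZ, hence also a_0...a_j Z when m divides a_0...a_j. So these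
    integral subgroups already form a basis at 0. *)
Lemma nbhs_sub_Nmult A : nbhs (0 : Ngrp a) A ->
  exists j, Nmult (prod_right a j) `<=` A.
Proof.
move=> [_ [_ [m [n [_ n0 [j /dvdnP[c jE]] _ ->]]]] mA].
exists j => x [z xE]; apply: mA; exists (z * (c * n)%N%:Z).
have n0' : n%:R != 0 :> rat by rewrite pnatr_eq0 -lt0n.
rewrite raddf0 subr0 xE jE intrM -pmulrn !natrM; by field.
Qed.

Lemma nbhs_ccl_Nmult (W : set (completion (Ngrp a))) :
  nbhs (0 : completion (Ngrp a)) W ->
  exists j, ccl (Nmult (prod_right a j)) `<=` W.
Proof.
move=> /nbhs_ccl[V /nbhs_sub_Nmult[j jV] VW]; exists j.
by apply: subset_trans VW; exact: ccl_sub.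
Qed.

Lemma Nmult_sub1 m : Nmult m `<=` Nmult 1.
Proof.
by move=> x [z xE]; exists (z * m%:Z); rewrite xE intrM -pmulrn mulr1.
Qed.

Lemma nbhs_Nmult1 : nbhs (0 : Ngrp a) (Nmult 1).
Proof. exact: (@nbhs_Nmult 1 0). Qed.

Lemma nbhs_Nmult_right j : nbhs (0 : Ngrp a) (Nmult (prod_right a j)).
Proof. exact: nbhs_Nmult (dvdnn _). Qed.

End NgrpMultiples.

(** * The lattice (s/d)Z attached to an isomorphism *)

Section OmegaIso.
Variables (a b : seq_ge2).
Variables (f : {additive Omega a -> Omega b}) (g : {additive Omega b -> Omega a}).
Hypotheses (fK : cancel f g) (gK : cancel g f).
Hypotheses (fc : continuous f) (gc : continuous g).

Local Notation ia := (@completion_map (Ngrp a)).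
Local Notation ib := (@completion_map (Ngrp b)).
Local Notation Ka := (ccl (@Nmult a 1)).
Local Notation Kb := (ccl (@Nmult b 1)).

Let sKa : subgroup Ka.
Proof. exact: ccl_subgroup (nbhs_Nmult1 a) (Nmult_subgroup a 1). Qed.

Let sKb : subgroup Kb.
Proof. exact: ccl_subgroup (nbhs_Nmult1 b) (Nmult_subgroup b 1). Qed.

Let sub_Ka m : ccl (Nmult m) `<=` Ka.
Proof. exact/ccl_sub/Nmult_sub1. Qed.

Let f_small (W : set (Omega b)) : nbhs (0 : Omega b) W ->
  exists j, ccl (Nmult (prod_right a j)) `<=` f @^-1` W.
Proof.
by move=> W0; apply: nbhs_ccl_Nmult; have := @fc 0 W; rewrite raddf0; exact.
Qed.

Let g_small (W : set (Omega a)) : nbhs (0 : Omega a) W ->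
  exists j, ccl (Nmult (prod_right b j)) `<=` g @^-1` W.
Proof.
by move=> W0; apply: nbhs_ccl_Nmult; have := @gc 0 W; rewrite raddf0; exact.
Qed.

Let nKa : nbhs (0 : Omega a) Ka.
Proof. by apply/nbhs_ccl; exists (Nmult 1) => //; exact: nbhs_Nmult1. Qed.

Let nKb : nbhs (0 : Omega b) Kb.
Proof. by apply/nbhs_ccl; exists (Nmult 1) => //; exact: nbhs_Nmult1. Qed.

(** Modulo the closure of Z in Omega_b, f(1) is some c/d, so d f(1) lies in that closure. If g(y)
    lies in the closure of Z in Omega_a, it is close to an integer u, so y is congruent to u f(1)
    and dy is an integer: the denominators are bounded by d. *)
Lemma image_lattice_bounded : exists k, forall y : Ngrp b,
  Ka (g (ib y)) -> exists t : int, val y = t%:~R / (prod_left b k.+1)%:R.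
Proof.
have [e eE] := Ngrp_int a 1.
have [x xE] := ccl_dense (f (ia e)) (nbhs_Nmult1 b).
have [c [k xval]] := Ngrp_frac x; exists k => y Ky.
set d := prod_left b k.+1 in xval *.
have d0 : d%:R != 0 :> rat by rewrite pnatr_eq0 -lt0n prod_left_gt0.
have Kd : Kb (f (ia e) *~ d).
  apply: (subgroup_subl sKb (y := ib (x *~ d))).
    by rewrite raddfMz -mulrzBl; exact: subgroupMz.
  apply/ccl_map; [exact: nbhs_Nmult1|exact: Nmult_subgroup|].
  by exists c; rewrite raddfMz /= xval -mulrzr -pmulrn divfK ?mulr1.
(* This j makes f carry the closure of a_0...a_j Z into that of Z, so replacing g(y) by an integer
   changes y only modulo the closure of Z. *)
have [j jK] := f_small nKb.
have [z zE] := ccl_dense (g (ib y)) (nbhs_Nmult_right a j).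
have [u uE] : Nmult 1 z.
  apply/(ccl_map z (nbhs_Nmult1 a) (Nmult_subgroup a 1)).
  by apply: (subgroup_subr sKa _ Ky); exact: sub_Ka zE.
have zu : z = e *~ u.
  by apply: val_inj; rewrite raddfMz /= eE uE mulr1.
have : Kb (ib (y *~ d)).
  rewrite raddfMz; apply: (subgroup_subl sKb (y := f (ia e) *~ d *~ u)).
    rewrite mulrzAC -mulrzBl; apply: (subgroupMz sKb).
    have fz : f (ia z) = f (ia e) *~ u by rewrite zu !raddfMz.
    by have := jK _ zE; rewrite /preimage/= raddfB gK fz.
  exact: subgroupMz.
move=> /(ccl_map _ (nbhs_Nmult1 b) (Nmult_subgroup b 1))[t tE].
exists t; move: tE; rewrite raddfMz /= -mulrzr -pmulrn mulr1 => <-.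
by rewrite mulfK.
Qed.

(* The closure of Z in Omega_a is carried by f to an open subgroup whose trace
   on N_b is (s/d)Z. *)
Lemma image_lattice : exists k (s : nat), (0 < s)%N /\ forall y : Ngrp b,
  Ka (g (ib y)) <->
  exists t : int, val y = t%:~R * (s%:R / (prod_left b k.+1)%:R).
Proof.
have [k kP] := image_lattice_bounded; exists k.
set d := prod_left b k.+1 in kP *.
have d0 : d%:R != 0 :> rat by rewrite pnatr_eq0 -lt0n prod_left_gt0.
(* The numerators over d of the trace form a subgroup of Z, whose positive generator is s. *)
pose A : set int := [set t | exists2 y, Ka (g (ib y)) & val y = t%:~R / d%:R].
have sA : subgroup A.
  split=> [|t u [y Ky yE] [z Kz zE]].
    exists 0; first by rewrite !raddf0; case: sKa.
    by rewrite raddf0 mul0r.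
  exists (y - z); first by rewrite !raddfB; case: sKa => _; exact.
  by rewrite raddfB /= yE zE rmorphB mulrBl.
(* The subgroup is nonzero: by continuity of g, some integer b_0...b_j lies in the trace, and its
   numerator over d is d b_0...b_j. *)
have exA : exists2 n : nat, (0 < n)%N & A n.
  have [j jK] := g_small nKa.
  exists (prod_right b j * d)%N; first by rewrite muln_gt0 prod_right_gt0 prod_left_gt0.
  have [y yE] := Ngrp_int b (prod_right b j).
  exists y; last by rewrite yE -!pmulrn natrM mulfK.
  apply: jK; apply/ccl_map; [exact: nbhs_Nmult_right|exact: Nmult_subgroup|].
  by exists 1; rewrite yE mul1r.
have [s s0 AE] := int_subgroup sA exA; exists s; split=> // y; split=> [Ky|[t yE]].
  have [t yE] := kP y Ky; have /AE[u tE] : A t by exists y.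
  by exists u; rewrite yE tE intrM -pmulrn mulrA.
have /AE[z Kz zE] : exists u, t * s%:Z = u * s%:Z by exists t.
suff -> : y = z by [].
by apply: val_inj; rewrite /= yE zE intrM -pmulrn mulrA.
Qed.

(** * Divisibility relations between the products of a and b *)

Section Ratio.
Variables (k0 s : nat).
Local Notation d := (prod_left b k0.+1).
Hypothesis latP : forall y : Ngrp b,
  Ka (g (ib y)) <-> exists t : int, val y = t%:~R * (s%:R / d%:R).

Let d0 : d%:R != 0 :> rat.
Proof. by rewrite pnatr_eq0 -lt0n prod_left_gt0. Qed.

Let a0 k : (prod_left a k)%:R != 0 :> rat.
Proof. by rewrite pnatr_eq0 -lt0n prod_left_gt0. Qed.

Let b0 k : (prod_left b k)%:R != 0 :> rat.
Proof. by rewrite pnatr_eq0 -lt0n prod_left_gt0. Qed.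

(* 1/l has order l modulo Z, and its image in N_b/(s/d)Z is represented by some
   c/n with d | n, an element killed by s * (n/d). *)
Lemma ratio_left_ab k :
  exists k', (d * prod_left a k.+1 %| s * prod_left b k'.+1)%N.
Proof.
have [x xE] := Ngrp_elt a 1 k.
have [j jK] := g_small nKa.
have [y /jK] := ccl_dense (f (ia x)) (nbhs_Nmult_right b j).
rewrite /preimage/= raddfB fK => xy.
have [c [k' yE]] := Ngrp_frac y; exists (maxn k' k0).
have /dvdnP[u uE] : (prod_left b k'.+1 %| prod_left b (maxn k' k0).+1)%N.
  by apply: prod_left_dvd; rewrite ltnS leq_maxl.
have /dvdnP[v vE] : (d %| prod_left b (maxn k' k0).+1)%N.
  by apply: prod_left_dvd; rewrite ltnS leq_maxr.
have : Ka (ia (x *~ (s * v)%N)).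
  rewrite raddfMz; apply: (subgroup_subl sKa (y := g (ib (y *~ (s * v)%N)))).
    have -> : g (ib (y *~ (s * v)%N)) = g (ib y) *~ (s * v)%N by rewrite !raddfMz.
    by rewrite -mulrzBl; exact: subgroupMz.
  apply/latP; exists (c * u%:Z).
  rewrite raddfMz /= yE intrM -[_ *~ (s * v)%N]mulrzr -!pmulrn natrM.
  have -> : u%:R = v%:R * d%:R / (prod_left b k'.+1)%:R :> rat.
    by apply: (canRL (mulfK (b0 _))); rewrite -!natrM -uE -vE.
  by field; rewrite d0 b0.
move=> /(ccl_map _ (nbhs_Nmult1 a) (Nmult_subgroup a 1))[t].
rewrite raddfMz /= xE mulr1 -mulrzr -pmulrn div1r mulrC => /(canRL (divfK (a0 _))) tE.
have /dvdnP[w wE] : (prod_left a k.+1 %| s * v)%N by apply/dvdn_ratP; exists t.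
by rewrite vE mulnA wE -mulnA dvdn_mull // mulnC.
Qed.

(** Take 1/n in N_b with n a multiple of b_(-1)...b_(-k-1). Modulo K, g(1/n) is an element of N_a,
    killed by its denominator l. Hence l/n lies in (s/d)Z, that is, sn divides dl. *)
Lemma ratio_left_ba k :
  exists k', (s * prod_left b k.+1 %| d * prod_left a k'.+1)%N.
Proof.
have [y yE] := Ngrp_elt b 1 (maxn k k0).
have [x xy] := ccl_dense (g (ib y)) (nbhs_Nmult1 a).
have [c [k' xE]] := Ngrp_frac x; exists k'; set l := prod_left a k'.+1 in xE *.
have kn : (prod_left b k.+1 %| prod_left b (maxn k k0).+1)%N.
  by apply: prod_left_dvd; rewrite ltnS leq_maxl.
have : Ka (g (ib (y *~ l))).
  have -> : g (ib (y *~ l)) = g (ib y) *~ l by rewrite !raddfMz.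
  apply: (subgroup_subl sKa (y := ia (x *~ l))).
    by rewrite raddfMz -mulrzBl; exact: subgroupMz.
  apply/ccl_map; [exact: nbhs_Nmult1|exact: Nmult_subgroup|].
  by exists c; rewrite raddfMz /= xE -mulrzr -pmulrn divfK ?mulr1 ?a0.
move=> /latP[t]; rewrite raddfMz /= yE -mulrzr -pmulrn => tE.
apply: (dvdn_trans (dvdn_mul (dvdnn s) kn)); apply/dvdn_ratP; exists t.
rewrite !natrM; have n0 := b0 (maxn k k0).+1.
have -> : l%:R = t%:~R * (s%:R / d%:R) * (prod_left b (maxn k k0).+1)%:R :> rat.
  by rewrite -tE; field.
by field.
Qed.

Let generator : exists2 r : Ngrp b, val r = s%:R / d%:R & Ka (g (ib r)).
Proof.
have [r rE] := Ngrp_elt b s k0; exists r; first by rewrite rE -pmulrn.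
by apply/latP; exists 1; rewrite rE mul1r -pmulrn.
Qed.

(** Let m = a_0...a_j and let V be the closure of mZ. By continuity g maps the closure of some m'Z,
    with m' = b_0...b_j', into V; write m' = c(s/d). Since c annihilates (s/d)Z modulo m'Z, and f(1)
    is approximated by elements of (s/d)Z, c lies in V, so m divides c. *)
Lemma ratio_right_ab j :
  exists j', (s * prod_right a j %| d * prod_right b j')%N.
Proof.
have [r rE Kr] := generator.
have [e eE] := Ngrp_int a 1.
set m := prod_right a j; pose V := ccl (@Nmult a m).
have nm : nbhs (0 : Ngrp a) (Nmult m) by exact: nbhs_Nmult_right.
have sV : subgroup V by exact: ccl_subgroup nm (Nmult_subgroup a m).
have [j' jV] : exists j', ccl (Nmult (prod_right b j')) `<=` g @^-1` V.
  by apply: g_small; apply/nbhs_ccl; exists (Nmult m).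
exists j'; set m' := prod_right b j' in jV *.
have nm' : nbhs (0 : Ngrp b) (Nmult m') by exact: nbhs_Nmult_right.
have [h hE] := Ngrp_int b m'.
have Vh : V (g (ib h)).
  apply: jV; apply/(ccl_map _ nm' (Nmult_subgroup b m')).
  by exists 1; rewrite hE mul1r.
have /latP[c cE] : Ka (g (ib h)) by exact: sub_Ka Vh.
have [y /jV] := ccl_dense (f (ia e)) nm'; rewrite /preimage/= raddfB fK => ey.
have Ke : Ka (ia e).
  apply/(ccl_map _ (nbhs_Nmult1 a) (Nmult_subgroup a 1)).
  by exists 1; rewrite eE mulr1.
have /latP[z zE] : Ka (g (ib y)).
  by apply: (subgroup_subr sKa _ Ke); exact: sub_Ka ey.
(* With y = z(s/d) and m' = c(s/d), both sides are zc(s/d); the right side shows that g sends it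
   into V. *)
have yh : y *~ c = h *~ z.
  by apply: val_inj; rewrite !raddfMz /= zE cE -[LHS]mulrzr -[RHS]mulrzr; ring.
have : V (ia (e *~ c)).
  apply: (subgroup_subl sV (y := g (ib (y *~ c)))).
    have -> : g (ib (y *~ c)) = g (ib y) *~ c by rewrite !raddfMz.
    by rewrite raddfMz -mulrzBl; exact: subgroupMz.
  have -> : g (ib (y *~ c)) = g (ib h) *~ z by rewrite yh !raddfMz.
  exact: subgroupMz.
move=> /(ccl_map _ nm (Nmult_subgroup a m))[t]; rewrite raddfMz /= eE => tE.
apply/dvdn_ratP; exists t; rewrite !natrM.
have -> : m'%:R = c%:~R * (s%:R / d%:R) :> rat by rewrite -cE hE.
by rewrite tE; field.
Qed.

(** Let m' = b_0...b_j, and let f map the closure of mZ into that of m'Z, with m = a_0...a_j'. The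
    element g(s/d) of K is an integer modulo the closure of mZ, so m times it lies in that closure.
    Applying f puts m(s/d) in m'Z. *)
Lemma ratio_right_ba j :
  exists j', (d * prod_right b j %| s * prod_right a j')%N.
Proof.
have [r rE Kr] := generator.
set m' := prod_right b j; pose W := ccl (@Nmult b m').
have nm' : nbhs (0 : Ngrp b) (Nmult m') by exact: nbhs_Nmult_right.
have [j' jW] : exists j', ccl (Nmult (prod_right a j')) `<=` f @^-1` W.
  by apply: f_small; apply/nbhs_ccl; exists (Nmult m').
exists j'; set m := prod_right a j' in jW *.
have nm : nbhs (0 : Ngrp a) (Nmult m) by exact: nbhs_Nmult_right.
have sm := ccl_subgroup nm (Nmult_subgroup a m).
have [x rx] := ccl_dense (g (ib r)) nm.
have [u uE] : Nmult 1 x.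
  apply/(ccl_map x (nbhs_Nmult1 a) (Nmult_subgroup a 1)).
  by apply: (subgroup_subr sKa _ Kr); exact: sub_Ka rx.
have /jW : ccl (Nmult m) (g (ib (r *~ m))).
  have -> : g (ib (r *~ m)) = g (ib r) *~ m by rewrite !raddfMz.
  apply: (subgroup_subl sm (y := ia (x *~ m))).
    by rewrite raddfMz -mulrzBl; exact: subgroupMz.
  apply/(ccl_map _ nm (Nmult_subgroup a m)).
  by exists u; rewrite raddfMz /= uE mulr1 -mulrzr -pmulrn.
rewrite /preimage/= gK => /(ccl_map _ nm' (Nmult_subgroup b m'))[z].
rewrite raddfMz /= rE -mulrzr -pmulrn => zE.
apply/dvdn_ratP; exists z; rewrite !natrM mulrCA -zE; by field.
Qed.

End Ratio.

End OmegaIso.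

Lemma topgroup_iso_ratio (a b : seq_ge2) : topgroup_iso (Omega a) (Omega b) ->
  exists p q : nat, [/\ (0 < p)%N, (0 < q)%N,
    (forall k, exists k', (q * prod_left a k.+1 %| p * prod_left b k'.+1)%N) /\
    (forall k, exists k', (p * prod_left b k.+1 %| q * prod_left a k'.+1)%N),
    forall j, exists j', (p * prod_right a j %| q * prod_right b j')%N &
    forall j, exists j', (q * prod_right b j %| p * prod_right a j')%N].
Proof.
move=> [f [g [fK gK fc gc]]].
pose gB := GRing.isZmodMorphism.Build _ _ g (can2_zmod_morphism fK gK).
pose g' : {additive Omega b -> Omega a} := HB.pack g gB.
have [k [s [s0 sP]]] := @image_lattice a b f g' gK fc gc.
exists s, (prod_left b k.+1); split=> //; first exact: prod_left_gt0.
- split=> [l|l]; first exact: (@ratio_left_ab a b f g' fK gc _ _ sP).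
  exact: (@ratio_left_ba a b g' _ _ sP).
- by move=> j; exact: (@ratio_right_ab a b f g' fK gc _ _ sP).
- by move=> j; exact: (@ratio_right_ba a b f g' gK fc _ _ sP).
Qed.

(** * Inclusion of the families U_a as divisibility *)

Section Ufam.
Implicit Types a b : int -> nat.

Lemma fracZ_sub_Nset a m n k : (forall i, 0 < a i)%N ->
  (n %| prod_left a k.+1)%N -> fracZ m n `<=` Nset a.
Proof.
move=> a0 /dvdnP[c cE] _ [z ->].
have := prodn_gt0 (fun i : nat => a0 (- i%:Z)) : (0 < prod_left a k.+1)%N.
rewrite cE muln_gt0 !lt0n -!(pnatr_eq0 rat) => /andP[c0 n0].
exists (z * (m * c)%N%:Z), k.+1; split=> //.
rewrite cE intrM -pmulrn !natrM; by field; rewrite c0 n0.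
Qed.

(** The conditions on m and n pass along the divisibilities. Conversely, test the inclusion on
    (1/l)Z and on rZ, for l and r the left and right products of a: (1/l)Z = (m/n)Z forces l to
    divide n, and rZ = (m/n)Z forces r to divide m. *)
Lemma Ufam_sub a b : (forall i, 0 < a i)%N -> (forall i, 0 < b i)%N ->
  Ufam a `<=` Ufam b <->
  (forall k, exists k', (prod_left a k.+1 %| prod_left b k'.+1)%N) /\
  (forall j, exists j', (prod_right a j %| prod_right b j')%N).
Proof.
move=> a0 b0.
have left0 k : (0 < prod_left a k)%N by exact: prodn_gt0.
have right0 k : (0 < prod_right a k)%N by exact: prodn_gt0.
split=> [ab|[abl abr] _ [_ [m [n [m0 n0 [j mj] [[//|k] _ nk] ->]]]]]; last first.
  have [k' kk'] := abl k; have [j' jj'] := abr j.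
  split; first exact: fracZ_sub_Nset (dvdn_trans nk kk').
  exists m, n; split=> //; first by exists j'; exact: dvdn_trans mj jj'.
  by exists k'.+1 => //; exact: dvdn_trans nk kk'.
split=> [k|j].
  have /ab[_ [m [n [m0 n0 _ [[//|k'] _ nk'] E]]]] :
      Ufam a (fracZ 1 (prod_left a k.+1)).
    split; first exact: fracZ_sub_Nset (dvdnn _).
    by exists 1, (prod_left a k.+1); split=> //; [exists 0; exact: dvd1n|exists k.+1].
  have : fracZ m n (1 / (prod_left a k.+1)%:R) by rewrite -E; exists 1; rewrite [RHS]mul1r.
  have n0' : n%:R != 0 :> rat by rewrite pnatr_eq0 -lt0n.
  have l0 : (prod_left a k.+1)%:R != 0 :> rat by rewrite pnatr_eq0 -lt0n.
  move=> [z zE]; exists k'; apply: dvdn_trans nk'; apply/dvdn_ratP.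
  exists (z * m%:Z); rewrite intrM -pmulrn.
  have -> : n%:R = (1 / (prod_left a k.+1)%:R) * n%:R * (prod_left a k.+1)%:R :> rat.
    by field.
  by rewrite zE; field.
have /ab[_ [m [n [m0 n0 [j' mj'] _ E]]]] : Ufam a (fracZ (prod_right a j) 1).
  split; first exact: (@fracZ_sub_Nset _ _ _ 0).
  exists (prod_right a j), 1; split=> //; first by exists j.
  by exists 1; rewrite ?dvd1n.
have : fracZ (prod_right a j) 1 (m%:R / n%:R) by rewrite E; exists 1; rewrite mul1r.
have n0' : n%:R != 0 :> rat by rewrite pnatr_eq0 -lt0n.
move=> [z zE]; exists j'; apply: dvdn_trans mj'; apply/dvdn_ratP.
exists (z * n%:Z); rewrite intrM -pmulrn.
have -> : m%:R = m%:R / n%:R * n%:R :> rat by field.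
by rewrite zE; field.
Qed.

(** The index is a successor because the empty product [prod_left _ 0] misses the entry at -1. *)
Lemma prod_left_rescale q p a k :
  prod_left (rescale q p a) k.+1 = (q * prod_left a k.+1)%N.
Proof.
rewrite /prod_left big_ltn // [in RHS]big_ltn // mulnA; congr (_ * _)%N.
by apply: eq_big_nat => -[|[|i]].
Qed.

Lemma prod_right_rescale q p a j :
  prod_right (rescale q p a) j = (p * prod_right a j)%N.
Proof.
rewrite /prod_right big_ltn // [in RHS]big_ltn // mulnA; congr (_ * _)%N.
by apply: eq_big_nat => -[|i].
Qed.

Lemma rescale_gt0 q p a : (0 < q)%N -> (0 < p)%N -> (forall i, 0 < a i)%N ->
  forall i, (0 < rescale q p a i)%N.
Proof.
move=> q0 p0 a0 i; rewrite /rescale.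
by case: ifP => _; [|case: ifP => _]; rewrite ?muln_gt0 ?q0 ?p0 ?a0.
Qed.

End Ufam.

(** Exchanging (a, p) with (b, q) gives the reverse inclusion, so this covers both halves of the
    equality of families. *)
Lemma Ufam_sub_rescale (a b : seq_ge2) p q : (0 < p)%N -> (0 < q)%N ->
  Ufam (rescale q p a) `<=` Ufam (rescale p q b) <->
  (forall k, exists k', (q * prod_left a k.+1 %| p * prod_left b k'.+1)%N) /\
  (forall j, exists j', (p * prod_right a j %| q * prod_right b j')%N).
Proof.
move=> p0 q0; have gt0 (c : seq_ge2) i : (0 < c i)%N.
  exact: leq_trans (seq_fun_ge2 c i).
rewrite Ufam_sub; try exact: rescale_gt0.
split=> -[abl abr]; split=> k.
- by have [k'] := abl k; rewrite !prod_left_rescale; exists k'.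
- by have [k'] := abr k; rewrite !prod_right_rescale; exists k'.
- by have [k'] := abl k; exists k'; rewrite !prod_left_rescale.
- by have [k'] := abr k; exists k'; rewrite !prod_right_rescale.
Qed.

(** * Multiplication by p/q from N_a to N_b *)

Section Scaling.
Variables (a b : seq_ge2) (p q : nat).
Hypotheses (p0 : (0 < p)%N) (q0 : (0 < q)%N).
Hypothesis leftP :
  forall k, exists k', (q * prod_left a k.+1 %| p * prod_left b k'.+1)%N.
Hypothesis rightP :
  forall j, exists j', (q * prod_right b j %| p * prod_right a j')%N.

(** [leftP] bounds the denominators, so the values lie in N_b. [rightP] sends a_0...a_j' Z into
    b_0...b_j Z, which is continuity at 0. *)
Lemma Ngrp_scaling : exists2 f : {additive Ngrp a -> Ngrp b}, continuous f &
  forall x, val (f x) = p%:R / q%:R * val x.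
Proof.
have q0' : q%:R != 0 :> rat by rewrite pnatr_eq0 -lt0n.
have Nx (x : Ngrp a) : Nset b (p%:R / q%:R * val x).
  have [z [k ->]] := Ngrp_frac x; have [k' /dvdn_ratP[w]] := leftP k.
  rewrite !natrM => wE; exists (z * w), k'.+1; split=> //.
  have a0 := prod_left_neq0 a k.+1; have b0 := prod_left_neq0 b k'.+1.
  have -> : p%:R = w%:~R * (q%:R * (prod_left a k.+1)%:R) / (prod_left b k'.+1)%:R :> rat.
    by rewrite -wE; field.
  by rewrite intrM; field; rewrite q0' a0 b0.
have [f fE] : exists f : {additive Ngrp a -> Ngrp b},
    forall x, val (f x) = p%:R / q%:R * val x.
  pose h x := MkN (mem_set (Nx x)).
  have hB : zmod_morphism h.
    by move=> x y; apply: val_inj; rewrite raddfB /= mulrBr.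
  pose hM := GRing.isZmodMorphism.Build _ _ h hB.
  by exists (HB.pack_for {additive Ngrp a -> Ngrp b} h hM).
exists f => // x A /nbhs_shift/nbhs_sub_Nmult[j jA].
have [j' /dvdn_ratP[w]] := rightP j; rewrite !natrM => wE.
apply/nbhs_shift; apply: filterS (nbhs_Nmult_right a j') => u [z uE].
rewrite /preimage/= raddfD; apply: jA; exists (z * w).
rewrite fE uE intrM; have -> : p%:R / q%:R * (z%:~R * (prod_right a j')%:R) =
  z%:~R * (p%:R * (prod_right a j')%:R) / q%:R :> rat by field.
by rewrite wE; field.
Qed.

End Scaling.

Theorem proposition5p2 (a b : seq_ge2) :
  topgroup_iso (Omega a) (Omega b) <->
  exists p q : nat, [/\ (1 <= p)%N, (1 <= q)%N &
    seq_sim (rescale q p a) (rescale p q b)].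
Proof.
split=> [/topgroup_iso_ratio|] [p [q [p0 q0]]].
  move=> [lab lba] rab rba; exists p, q; split=> //.
  by apply/seteqP; split; apply/Ufam_sub_rescale.
move=> /seteqP[/(Ufam_sub_rescale _ _ p0 q0)[lab rab]].
move=> /(Ufam_sub_rescale _ _ q0 p0)[lba rba].
(* Multiplication by p/q and by q/p are mutually inverse and continuous, so they extend to the
   completions. *)
have [f fc fE] := Ngrp_scaling q0 lab rba.
have [g gc gE] := Ngrp_scaling p0 lba rab.
have p0' : p%:R != 0 :> rat by rewrite pnatr_eq0 -lt0n.
have q0' : q%:R != 0 :> rat by rewrite pnatr_eq0 -lt0n.
apply: (@completion_iso _ _ f g) => // x; apply: val_inj.
  by rewrite gE fE; field; rewrite p0' q0'.
by rewrite fE gE; field; rewrite p0' q0'.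
Qed.
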